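(* There exists a linear-time separation algorithm for the facet defining inequalities of $conv(S^U)$: given $n$, $r>0$, $u$ and a point $(\bar x,\bar y)\in\mathbb{R}^n\times\mathbb{R}^n$, the algorithm decides in $O(n)$ time whether $(\bar x,\bar y)\in conv(S^U)$ and, if $(\bar x,\bar y)\notin conv(S^U)$, it outputs an inequality violated by $(\bar x,\bar y)$ that is either a bound constraint ($x_i\le u_i$, $x_i\ge 0$ or $y_i\ge 0$ for some $i\in N$) or an inequality of the form $$\sum_{i=1}^n l_i^{k_i}(x_i,y_i)\ge 1,\qquad (k_i)_{i=1}^n\in\prod_{i=1}^n\bar K_i ,$$ all of which are valid for $conv(S^U)$.
   Context: Let $n\ge 1$, $N=\{1,\dots,n\}$, $r>0$ a real number and $u=(u_1,\dots,u_n)$ a vector of positive integers. Define $$S^U=\Big\{(x,y)\in\mathbb{Z}^n_+\times\mathbb{R}^n_+ : \sum_{i=1}^n x_iy_i\ge r,\ x\le u\Big\},$$ where $\mathbb{R}_+=[0,\infty)$, $\mathbb{Z}_+=\mathbb{Z}\cap[0,\infty)$ and $x\le u$ is componentwise. $conv$ denotes convex hull. For $i\in N$ let $K_i=\{1,\dots,u_i\}$, $\bar K_i=K_i\cup\{u_i+1\}$ and $\bar u_i=r/u_i$. For $k\in K_i$ set $$l_i^{k}(x_i,y_i)=a_kx_i+b_ky_i,\qquad a_k=\frac{1}{2k-1},\quad b_k=\frac{k(k-1)}{r(2k-1)},$$ and set $l_i^{u_i+1}(x_i,y_i)=y_i/\bar u_i$. The paper refers to the inequalities $\sum_i l_i^{k_i}(x_i,y_i)\ge1$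 together with the bound constraints as the facet defining inequalities of $conv(S^U)$. Time is measured by the number of elementary operations (arithmetic operations, comparisons, square roots and floor/rounding operations), each counted as $O(1)$; in particular the bound does not depend on the magnitude of $u$. *)

(* Defs.v *)
From mathcomp Require Import all_boot all_order all_algebra.
From mathcomp Require Import archimedean boolp classical_sets reals convex.

Set Implicit Arguments.
Unset Strict Implicit.
Unset Printing Implicit Defensive.

Import Order.TTheory GRing.Theory Num.Theory.

Local Open Scope classical_set_scope.
Local Open Scope ring_scope.

Notation xyspace R n := ('rV[R]_n * 'rV[R]_n)%type.

Definition conv_hull (R : realType) (M : lmodType R) (A : set M) : set M :=
  smallest (@convex_set R M) A.

Definition SU (R : realType) (n : nat) (r : R) (u : 'I_n -> nat) :
    set (xyspace R n) :=
  [set p : xyspace R n |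
         [/\ forall i, p.1 0 i \is a Num.nat,
             forall i, 0 <= p.2 0 i,
             r <= \sum_(i < n) p.1 0 i * p.2 0 i
           & forall i, p.1 0 i <= (u i)%:R]].

Definition coef_a (R : realType) (k : nat) : R := 1 / (2 * k%:R - 1).

Definition coef_b (R : realType) (r : R) (k : nat) : R :=
  (k%:R * (k%:R - 1)) / (r * (2 * k%:R - 1)).

(* The form $l_i^k$ for $u_i = m$; it is only meant for $1 \le k \le m + 1$. *)
Definition lform (R : realType) (r : R) (m k : nat) (x y : R) : R :=
  if k == m.+1 then y / (r / m%:R) else coef_a R k * x + coef_b r k * y.

Inductive ineq (n : nat) : Type :=
| XUpper of 'I_n              (* x_i <= u_i *)
| XLower of 'I_n              (* x_i >= 0 *)
| YLower of 'I_n              (* y_i >= 0 *)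
| LSum of ('I_n -> nat).      (* \sum_i l_i^{k_i}(x_i, y_i) >= 1 *)

(* Membership in the family: $k_i \in \{1, \dots, u_i + 1\}$ for all $i$. *)
Definition admissible (n : nat) (u : 'I_n -> nat) (c : ineq n) : Prop :=
  if c is LSum k then forall i, (1 <= k i <= (u i).+1)%N else True.

Definition satisfies (R : realType) (n : nat) (r : R) (u : 'I_n -> nat)
    (c : ineq n) (p : xyspace R n) : Prop :=
  match c with
  | XUpper i => p.1 0 i <= (u i)%:R
  | XLower i => 0 <= p.1 0 i
  | YLower i => 0 <= p.2 0 i
  | LSum k => 1 <= \sum_(i < n) lform r (u i) (k i) (p.1 0 i) (p.2 0 i)
  end.

(* Algorithms are programs for a real random-access machine.  A program is a
   finite piece of first-order syntax in which neither n nor the data occur and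
   whose only constants are integers, so one program treats all inputs and no
   computation can take place outside the machine.  The memory consists of
   arrays of reals, named by naturals; a scalar variable is a cell with a
   constant index. *)

Inductive expr : Type :=
| EConst of int
| ERead of nat & expr         (* array name, index *)
| EAdd of expr & expr
| ESub of expr & expr
| EMul of expr & expr
| EDiv of expr & expr
| ESqrt of expr
| EFloor of expr.

Inductive test : Type :=
| TLe of expr & expr
| TLt of expr & expr
| TNot of test
| TAnd of test & test.

Inductive cmd : Type :=
| Skip
| Write of nat & expr & expr  (* array name, index, value *)
| Seq of cmd & cmd
| If of test & cmd & cmd
| While of test & cmd.

Definition store (R : realType) : Type := nat -> nat -> R.

Definition update (R : realType) (s : store R) (a j : nat) (v : R) : store R :=
  fun a' j' => if (a' == a) && (j' == j) then v else s a' j'.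

(* Indices are real values, truncated to naturals; as in the library, a
   quotient by 0 and the square root of a negative number are 0. *)
Fixpoint eval (R : realType) (s : store R) (e : expr) : R :=
  match e with
  | EConst z => z%:~R
  | ERead a e1 => s a (Num.truncn (eval s e1))
  | EAdd e1 e2 => eval s e1 + eval s e2
  | ESub e1 e2 => eval s e1 - eval s e2
  | EMul e1 e2 => eval s e1 * eval s e2
  | EDiv e1 e2 => eval s e1 / eval s e2
  | ESqrt e1 => Num.sqrt (eval s e1)
  | EFloor e1 => (Num.floor (eval s e1))%:~R
  end.

Fixpoint evalt (R : realType) (s : store R) (t : test) : bool :=
  match t with
  | TLe e1 e2 => eval s e1 <= eval s e2
  | TLt e1 e2 => eval s e1 < eval s e2
  | TNot t1 => ~~ evalt s t1
  | TAnd t1 t2 => evalt s t1 && evalt s t2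
  end.

(* Every node of an expression or test costs one unit, memory accesses and
   constants included. *)
Fixpoint ecost (e : expr) : nat :=
  match e with
  | EConst _ => 1
  | ERead _ e1 | ESqrt e1 | EFloor e1 => (ecost e1).+1
  | EAdd e1 e2 | ESub e1 e2 | EMul e1 e2 | EDiv e1 e2 =>
      (ecost e1 + ecost e2).+1
  end.

Fixpoint tcost (t : test) : nat :=
  match t with
  | TLe e1 e2 | TLt e1 e2 => (ecost e1 + ecost e2).+1
  | TNot t1 => (tcost t1).+1
  | TAnd t1 t2 => (tcost t1 + tcost t2).+1
  end.

(* [exec c s s' T]: started in s, the program c halts in s' at total cost T. *)
Inductive exec (R : realType) : cmd -> store R -> store R -> nat -> Prop :=
| exec_skip s : exec Skip s s 1
| exec_write a e1 e2 s :
    exec (Write a e1 e2) s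
         (update s a (Num.truncn (eval s e1)) (eval s e2))
         (ecost e1 + ecost e2).+1
| exec_seq c1 c2 s s1 s2 T1 T2 :
    exec c1 s s1 T1 -> exec c2 s1 s2 T2 -> exec (Seq c1 c2) s s2 (T1 + T2)
| exec_if_true t c1 c2 s s1 T :
    evalt s t -> exec c1 s s1 T -> exec (If t c1 c2) s s1 (tcost t + T).+1
| exec_if_false t c1 c2 s s1 T :
    ~~ evalt s t -> exec c2 s s1 T -> exec (If t c1 c2) s s1 (tcost t + T).+1
| exec_while_false t c s :
    ~~ evalt s t -> exec (While t c) s s (tcost t).+1
| exec_while_true t c s s1 s2 T1 T2 :
    evalt s t -> exec c s s1 T1 -> exec (While t c) s1 s2 T2 ->
    exec (While t c) s s2 (tcost t + T1 + T2).+1.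

Lemma exec_det (R : realType) (c : cmd) (s s1 s2 : store R) (T1 T2 : nat) :
  exec c s s1 T1 -> exec c s s2 T2 -> s1 = s2 /\ T1 = T2.
Proof.
move=> e1; elim: e1 s2 T2 => {c s s1 T1}.
- by move=> s s2 T2 e2; inversion e2.
- by move=> a f1 f2 s s2 T2 e2; inversion e2.
- move=> c1 c2 s s1 s2 T1 T2 _ IH1 _ IH2 s' T' e2.
  inversion e2 as [| |? ? ? ? ? ? ? f1 f2| | | |]; subst.
  by have [? ?] := IH1 _ _ f1; subst; have [-> ->] := IH2 _ _ f2.
- move=> t c1 c2 s s1 T ht _ IH s' T' e2.
  inversion e2 as [| | |? ? ? ? ? ? h f|? ? ? ? ? ? h f| |]; subst.
    by have [-> ->] := IH _ _ f.
  by rewrite ht in h.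
- move=> t c1 c2 s s1 T ht _ IH s' T' e2.
  inversion e2 as [| | |? ? ? ? ? ? h f|? ? ? ? ? ? h f| |]; subst.
    by rewrite h in ht.
  by have [-> ->] := IH _ _ f.
- move=> t c s ht s' T' e2.
  inversion e2 as [| | | | |? ? ? h|? ? ? ? ? ? ? h f1 f2]; subst=> //.
  by rewrite h in ht.
- move=> t c s s1 s2 T1 T2 ht _ IH1 _ IH2 s' T' e2.
  inversion e2 as [| | | | |? ? ? h|? ? ? ? ? ? ? h f1 f2]; subst.
    by rewrite ht in h.
  by have [? ?] := IH1 _ _ f1; subst; have [-> ->] := IH2 _ _ f2.
Qed.

Definition in_n := 0%N.
Definition in_r := 1%N.
Definition in_u := 2%N.
Definition in_x := 3%N.
Definition in_y := 4%N.
Definition out_tag := 5%N.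
Definition out_idx := 6%N.
Definition out_k := 7%N.

(* Index i of a vector is stored in cell i of its array, counting from 0. *)
Definition vec_array (R : realType) (n : nat) (v : 'I_n -> R) (j : nat) : R :=
  if insub j is Some i then v i else 0.

Definition input (R : realType) (n : nat) (r : R) (u : 'I_n -> nat)
    (p : xyspace R n) : store R :=
  fun a j =>
    if a == in_n then (if j == 0%N then n%:R else 0)
    else if a == in_r then (if j == 0%N then r else 0)
    else if a == in_u then vec_array (fun i => (u i)%:R) j
    else if a == in_x then vec_array (fun i => p.1 0 i) j
    else if a == in_y then vec_array (fun i => p.2 0 i) j
    else 0.

(* How an answer is read off a final store; [None] is the answer "the point
   belongs to the convex hull", and [Some c] returns the inequality c. *)
Definition returns (R : realType) (n : nat) (s : store R)
    (ans : option (ineq n)) : Prop :=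
  match ans with
  | None => s out_tag 0%N = 0
  | Some (XUpper i) => s out_tag 0%N = 1 /\ s out_idx 0%N = (i : nat)%:R
  | Some (XLower i) => s out_tag 0%N = 2 /\ s out_idx 0%N = (i : nat)%:R
  | Some (YLower i) => s out_tag 0%N = 3 /\ s out_idx 0%N = (i : nat)%:R
  | Some (LSum k) => s out_tag 0%N = 4 /\
      forall i : 'I_n, s out_k i = (k i)%:R
  end.

(* Main.v *)
Require Import Defs.
From mathcomp Require Import all_boot all_order all_algebra.
From mathcomp Require Import archimedean boolp classical_sets reals convex.
From mathcomp Require Import interval_inference ring lra zify.

(** The inequalities are valid because every form [l_i^k] at an integer point
    is at least [min 1 (x_i y_i / r)] ([lform_ge_product]); summing over [i] gives
    1 on [S^U], and half-spaces are convex ([hull_satisfies]).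

    Conversely, let a point satisfy the bounds, and let [g_i] be the least value
    at [(x_i, y_i)] of the forms of coordinate [i], with [\sum_i g_i >= 1].
    Normalise the [g_i] to weights [w_i] of sum 1.  Each pair [(x_i, y_i)] splits
    as [w_i] times a pair on which all forms are at least 1, plus [1 - w_i] times
    a pair in the box ([split_coord]).  Forms at least 1 describe the convex hull
    of the integer pairs of the box with product at least [r], so a point with such a pair in
    coordinate [i] and arbitrary box pairs elsewhere is in [conv(S^U)]
    ([one_strong_coord_hull]); the given point is the combination of these points
    with weights [w_i] ([hull_of_lower_bounds]).

    Hence, for a point within the bounds, membership only depends on the sum over
    [i] of the smallest form of coordinate [i].  As [k] grows the forms first
    decrease and then increase, with the turning point at [k^2 > x_i r / y_i], so
    the best index is found with one comparison, one square root and one floor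
    ([best_indexP]).  If the sum of these minima is below 1, the minimising indices
    are a violated inequality.  One loop over the coordinates checks the bounds and
    accumulates this sum; its body is loop-free and so has constant cost, whatever
    the size of [u] ([exec_for], [separation_correct]). *)

Set Implicit Arguments.
Unset Strict Implicit.
Unset Printing Implicit Defensive.

Import Order.TTheory GRing.Theory Num.Theory.
Local Open Scope classical_set_scope.
Local Open Scope ring_scope.

(** * The linear forms *)

Lemma lform_lastE (R : realType) (r : R) (m : nat) (x y : R) :
  lform r m m.+1 x y = m%:R * (y / r).
Proof. by rewrite /lform eqxx invf_div mulrC mulrAC mulrA. Qed.

Lemma twice_sub1_gt0 (R : realType) (k : nat) : (1 <= k)%N -> 0 < 2 * k%:R - 1 :> R.
Proof. by rewrite -(ler_nat R) => ?; lra. Qed.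

Lemma lformE (R : realType) (r : R) (m k : nat) (x y : R) : 0 < r ->
  (1 <= k <= m)%N ->
  lform r m k x y = (x + k%:R * (k%:R - 1) * (y / r)) / (2 * k%:R - 1).
Proof.
move=> r0 /andP[k1 km]; rewrite /lform ltn_eqF// /coef_a /coef_b.
have := @twice_sub1_gt0 R k k1 => d0.
by field; lra.
Qed.

Lemma lform_combo (R : realType) (r : R) (m k : nat) (a b x y x' y' : R) :
  lform r m k (a * x + b * x') (a * y + b * y') =
  a * lform r m k x y + b * lform r m k x' y'.
Proof. by rewrite /lform; case: ifP => _; ring. Qed.

Lemma lform_ge0 (R : realType) (r : R) (m k : nat) (x y : R) : 0 < r ->
  (1 <= k <= m.+1)%N -> 0 <= x -> 0 <= y -> 0 <= lform r m k x y.
Proof.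
move=> r0 /andP[k1]; rewrite leq_eqVlt ltnS => /orP[/eqP->|km] x0 y0.
  by rewrite lform_lastE mulr_ge0 ?divr_ge0// ltW.
rewrite lformE ?k1//.
have k1R : 1 <= k%:R :> R by rewrite ler1n.
have yr0 : 0 <= y / r by rewrite divr_ge0// ltW.
by rewrite divr_ge0 ?(ltW (twice_sub1_gt0 _ _))// addr_ge0// mulr_ge0// mulr_ge0//; lra.
Qed.

(** No integer lies strictly between two consecutive integers: this is the only
    place where the integrality of [x] enters the validity proof. *)
Lemma consecutive_prod_ge0 (R : realType) (i k : nat) :
  0 <= (i%:R - k%:R) * (i%:R - k%:R + 1) :> R.
Proof.
have [ki|ik] := leqP k i.
  have : k%:R <= i%:R :> R by rewrite ler_nat.
  nra.
have : i%:R + 1 <= k%:R :> R by rewrite natr1 ler_nat.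
nra.
Qed.

(** The heart of validity: at an integer [x = i], writing [t = i * (y / r)], the
    form is at least [min 1 t].  With the denominator cleared and both sides
    multiplied by [i], this reads [i^2 + k (k - 1) t >= (2 k - 1) i t] for
    [t <= 1], and it holds because [(2 k - 1) i - k (k - 1)] is at most [i^2] by
    [consecutive_prod_ge0].  Truncating at 1 costs nothing, as the inequalities
    only ask for a sum at least 1. *)
Lemma lform_ge_product (R : realType) (r : R) (m k i : nat) (y : R) : 0 < r ->
  (1 <= k <= m.+1)%N -> (i <= m)%N -> 0 <= y ->
  Num.min 1 (i%:R * (y / r)) <= lform r m k i%:R y.
Proof.
move=> r0 /andP[k1]; rewrite leq_eqVlt ltnS => /orP[/eqP->|km] im y0.
  rewrite lform_lastE ge_min ler_wpM2r ?orbT ?ler_nat//.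
  by rewrite divr_ge0// ltW.
rewrite lformE ?k1// ler_pdivlMr ?twice_sub1_gt0//.
set Y := y / r; have Y0 : 0 <= Y by rewrite divr_ge0// ltW.
case: i im => [|i] im.
  rewrite mul0r min_r// mul0r add0r mulr_ge0// mulr_ge0// subr_ge0.
  by rewrite ler1n.
have := @consecutive_prod_ge0 R i.+1 k; have i1 : 1 <= i.+1%:R :> R by rewrite ler1n.
have k1R : 1 <= k%:R :> R by rewrite ler1n.
move: i.+1%:R k%:R i1 k1R => {i im k1 km}a b a1 b1 h.
have : Num.min 1 (a * Y) <= 1 by rewrite ge_min lexx.
have : Num.min 1 (a * Y) <= a * Y by rewrite ge_min lexx orbT.
have : 0 <= Num.min 1 (a * Y) by rewrite le_min ler01 mulr_ge0//; lra.
move: (Num.min _ _) => t t0 taY t1.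
have a0 : 0 < a by lra.
rewrite -(ler_pM2l a0).
have e1 : b * (b - 1) * t <= b * (b - 1) * (a * Y).
  by rewrite ler_wpM2l// mulr_ge0; lra.
have e2 : t * ((2 * b - 1) * a - b * (b - 1)) <= t * a ^+ 2.
  by rewrite ler_wpM2l//; nra.
have e3 : t * a ^+ 2 <= a ^+ 2 by rewrite ler_piMl// sqr_ge0.
nra.
Qed.

(** * Validity *)

Lemma min1_sum_le (R : realType) (I : Type) (s : seq I) (t : I -> R) :
  (forall i, 0 <= t i) -> Num.min 1 (\sum_(i <- s) t i) <= \sum_(i <- s) Num.min 1 (t i).
Proof.
move=> t0; elim: s => [|i s IH]; first by rewrite !big_nil ge_min lexx orbT.
rewrite !big_cons.
have : 0 <= \sum_(j <- s) Num.min 1 (t j).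
  by apply: sumr_ge0 => j _; rewrite le_min ler01 t0.
have : 0 <= \sum_(j <- s) t j by apply: sumr_ge0.
move: IH; have := t0 i.
move: (t i) (\sum_(j <- s) t j) (\sum_(j <- s) Num.min 1 (t j)) => a b c.
by case: (leP 1 a); case: (leP 1 b); case: (leP 1 (a + b)) => *; lra.
Qed.

Lemma SU_satisfies (R : realType) (n : nat) (r : R) (u : 'I_n -> nat)
    (c : ineq n) (p : xyspace R n) :
  0 < r -> admissible u c -> SU r u p -> satisfies r u c p.
Proof.
move=> r0; case: c => [i|i|i|k] /= adm [xN y0 xy xu]//.
  by rewrite natr_ge0.
pose t i := p.1 0 i * (p.2 0 i / r).
have t0 i : 0 <= t i.
  by apply: mulr_ge0; [exact: natr_ge0|rewrite divr_ge0// ltW].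
have : 1 <= \sum_i t i.
  rewrite -(ler_pM2r r0) mul1r mulr_suml (le_trans xy)// ler_sum// => i _.
  by rewrite /t mulrA divfK ?gt_eqF.
move=> st; have := min1_sum_le (index_enum 'I_n) t0.
rewrite (min_l st) => /le_trans; apply; apply: ler_sum => i _.
have /natrP[j xj] := xN i.
rewrite /t xj; apply: lform_ge_product => //.
by rewrite -(ler_nat R) -xj.
Qed.

Lemma convex_set_combo (R : realType) (M : lmodType R) (C : set M) (a b : R) (p q : M) :
  @convex_set R M C -> 0 <= a -> 0 <= b -> a + b = 1 -> C p -> C q ->
  C (a *: p + b *: q).
Proof.
move=> cC a0 b0 ab Cp Cq.
have a01 : (0 <= a <= 1)%R by rewrite a0/=; lra.
have := cC p q (Itv01 a0 (proj2 (andP a01))) (mem_set Cp) (mem_set Cq).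
rewrite inE /conv/= /unstable.onem.
by have -> : b = 1 - a by lra.
Qed.

(** Each inequality defines a half-space, so it passes from [SU] to its hull. *)
Lemma satisfies_convex (R : realType) (n : nat) (r : R) (u : 'I_n -> nat)
    (c : ineq n) : @convex_set R (xyspace R n) [set p | satisfies r u c p].
Proof.
move=> p q t; rewrite !inE /conv/=.
set b := (X in _ + X *: _); have tb : t%:inum + b = 1 by rewrite /b /unstable.onem; lra.
have t0 : 0 <= t%:inum by [].
have t1 : t%:inum <= 1 by [].
have b0 : 0 <= b by move: t1; lra.
move: (t%:inum) b t0 b0 tb {t1} => {t}a b a0 b0 ab.
case: c => [i|i|i|k] /=; rewrite ?mxE.
- by nra.
- by nra.
- by nra.
move=> hp hq; under eq_bigr do rewrite !mxE lform_combo.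
rewrite big_split/= -!mulr_sumr.
by nra.
Qed.

Lemma hull_satisfies (R : realType) (n : nat) (r : R) (u : 'I_n -> nat)
    (c : ineq n) (p : xyspace R n) :
  0 < r -> admissible u c -> conv_hull (SU r u) p -> satisfies r u c p.
Proof.
move=> r0 adm; apply: (@smallest_sub _ _ _ [set p | satisfies r u c p]).
  exact: satisfies_convex.
by move=> q; apply: SU_satisfies.
Qed.

(** * Points satisfying the inequalities lie in the hull *)

(** Terms of weight 0 are exempt from membership in [C]: a coordinate that does
    not contribute to the sum of forms has no point to offer. *)
Lemma convex_sum (R : realType) (M : lmodType R) (C : set M) (I : finType)
    (w : I -> R) (P : I -> M) :
  @convex_set R M C -> (forall i, 0 <= w i) -> \sum_i w i = 1 ->
  (forall i, 0 < w i -> C (P i)) -> C (\sum_i w i *: P i).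
Proof.
move=> cC w0 w1 CP.
(* The induction below needs a point of C for its base case. *)
have [q0 Cq0] : exists q, C q.
  case: (pselect (exists i, 0 < w i)) => [[i /CP ?]|h]; first by exists (P i).
  move: w1; rewrite big1 => [/esym/eqP|i _]; first by rewrite oner_eq0.
  by apply/eqP; rewrite eq_le w0 andbT leNgt; apply/negP => ?; apply: h; exists i.
suff [q Cq e] : exists2 q, C q &
    \sum_(i <- index_enum I) w i *: P i = (\sum_(i <- index_enum I) w i) *: q.
  by rewrite e w1 scale1r.
elim: (index_enum I) => [|i s [q Cq IH]].
  by exists q0; rewrite // !big_nil scale0r.
rewrite !big_cons IH.
have [->|wi] := eqVneq (w i) 0; first by exists q; rewrite // scale0r !add0r.
have {}wi : 0 < w i by rewrite lt_neqAle eq_sym wi w0.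
set S := \sum_(j <- s) w j; have S0 : 0 <= S by apply: sumr_ge0.
have wS : w i + S != 0 by rewrite gt_eqF//; lra.
exists ((w i / (w i + S)) *: P i + (S / (w i + S)) *: q).
  apply: convex_set_combo => //; [| |by field|exact: CP];
    by rewrite divr_ge0//; lra.
by rewrite scalerDr !scalerA; congr (_ *: _ + _ *: _); field.
Qed.

Definition set_coord (R : realType) (n : nat) (p : xyspace R n) (i : 'I_n)
    (a b : R) : xyspace R n :=
  (\row_j (if j == i then a else p.1 0 j), \row_j (if j == i then b else p.2 0 j)).

Lemma convex_coord (R : realType) (n : nat) (C : set (xyspace R n))
    (p : xyspace R n) (i : 'I_n) (s t a b a' b' : R) :
  @convex_set R (xyspace R n) C -> 0 <= s -> 0 <= t -> s + t = 1 ->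
  p.1 0 i = s * a + t * a' -> p.2 0 i = s * b + t * b' ->
  C (set_coord p i a b) -> C (set_coord p i a' b') -> C p.
Proof.
move=> cC s0 t0 st pa pb C1 C2.
have := @convex_set_combo R _ C s t _ _ cC s0 t0 st C1 C2.
congr (C _); case: p pa pb {C1 C2} => x y /= pa pb.
by congr pair; apply/rowP => j; rewrite !mxE; case: eqP => [->//|_];
  rewrite -mulrDl st mul1r.
Qed.

Definition in_box (R : realType) (m : nat) (x y : R) : Prop :=
  [/\ 0 <= x, x <= m%:R & 0 <= y].

(** If a single coordinate already gives a product at least [r], the others are
    free in their boxes; each of them that is fractional is a convex combination
    of its two integer neighbours, so the coordinates can be rounded one by one
    until the point lies in [SU]. *)
Lemma one_product_hull (R : realType) (n : nat) (r : R) (u : 'I_n -> nat)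
    (C : set (xyspace R n)) (i : 'I_n) :
  @convex_set R (xyspace R n) C -> SU r u `<=` C ->
  forall (p : xyspace R n),
  (forall j, in_box (u j) (p.1 0 j) (p.2 0 j)) ->
  p.1 0 i \is a Num.nat -> r <= p.1 0 i * p.2 0 i -> C p.
Proof.
move=> cC SC p pbox xi ri.
(* s lists the coordinates that may still be fractional. *)
suff H (s : seq 'I_n) : (forall j, j \notin s -> p.1 0 j \is a Num.nat) -> C p.
  by apply: (H (enum 'I_n)) => j; rewrite mem_enum.
elim: s p pbox xi ri => [|j s IH] p pbox xi ri ps.
  apply: SC; split=> [j|j||j]; [exact: ps|by case: (pbox j)| |by case: (pbox j)].
  rewrite (bigD1 i)//= (le_trans ri)// lerDl sumr_ge0// => j _.
  by case: (pbox j) => *; rewrite mulr_ge0.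
have [jN|jN] := boolP (p.1 0 j \is a Num.nat).
  apply: IH => // k ks; have [->//|kj] := eqVneq k j.
  by apply: ps; rewrite inE negb_or kj.
have ij : i != j by apply: contraNneq jN => <-.
have [x0 xu y0] := pbox j.
have /andP[mx xm] := truncn_itv x0.
set m := Num.truncn _ in mx xm.
have mN : m%:R != p.1 0 j by apply: contraNneq jN => <-; rewrite natr_nat.
have mx' : m%:R < p.1 0 j by rewrite lt_neqAle mN.
have mu : (m < u j)%N by rewrite -(ltr_nat R); lra.
have step (a : nat) : (a <= u j)%N -> C (set_coord p j a%:R (p.2 0 j)).
  move=> au; apply: IH; rewrite /= ?mxE ?(negPf ij)//.
  - move=> k; rewrite !mxE; case: eqP => [->|_]; last exact: pbox.
    by split; rewrite ?ler_nat.
  - move=> k ks; rewrite mxE; case: eqP => [_|/eqP kj]; first exact: natr_nat.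
    by apply: ps; rewrite inE negb_or kj.
apply: (@convex_coord R n C p j (m.+1%:R - p.1 0 j) (p.1 0 j - m%:R)
  m%:R (p.2 0 j) m.+1%:R (p.2 0 j) cC); rewrite -?natr1; try lra; try ring.
- by apply: step; apply: ltnW.
- by rewrite natr1; apply: step.
Qed.

(** In the plane of coordinate [i], the forms bounded below by 1 cut out the
    convex hull of the integer points with [x * y >= r]: for [k >= 2] the form of
    index [k] equals 1 on the chord through [(k - 1, r / (k - 1))] and
    [(k, r / k)], index 1 says [x >= 1], and the last index says [y >= r / u_i].
    A point above the chord of its own interval is a combination of the ends of
    that chord, both raised by the same amount. *)
Lemma one_strong_coord_hull (R : realType) (n : nat) (r : R) (u : 'I_n -> nat)
    (C : set (xyspace R n)) (i : 'I_n) (p : xyspace R n) :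
  0 < r -> (0 < u i)%N ->
  @convex_set R (xyspace R n) C -> SU r u `<=` C ->
  (forall j, in_box (u j) (p.1 0 j) (p.2 0 j)) ->
  (forall k, (1 <= k <= (u i).+1)%N -> 1 <= lform r (u i) k (p.1 0 i) (p.2 0 i)) ->
  C p.
Proof.
move=> r0 u0 cC SC pbox hl.
have [x0 xu y0] := pbox i.
have /andP[mx xm] := truncn_itv x0.
set m := Num.truncn _ in mx xm.
have x1 : 1 <= p.1 0 i.
  have := hl 1%N isT; rewrite lformE ?u0//.
  by rewrite subrr mulr0 mul0r addr0 mulr1 (_ : 2 - 1 = 1) ?divr1//; ring.
have m1 : (1 <= m)%N by rewrite -ltnS -(ltr_nat R) (le_lt_trans x1).
have mle : (m <= u i)%N by rewrite -(ler_nat R); lra.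
(* On the right edge x = u_i no chord is available and the last form is used. *)
move: (mle); rewrite leq_eqVlt => /orP[/eqP mu|mu].
  have xE : p.1 0 i = (u i)%:R by move: mx; rewrite mu; lra.
  apply: (@one_product_hull R n r u C i) => //; rewrite xE ?natr_nat//.
  have := hl (u i).+1; rewrite leqnn => /(_ isT).
  by rewrite lform_lastE mulrA ler_pdivlMr// mul1r.
have := hl m.+1 mle.
rewrite lformE ?mu// ler_pdivlMr ?twice_sub1_gt0// mul1r.
have [x [y [xE yE]]] : exists x y, x = p.1 0 i /\ y = p.2 0 i.
  by exists (p.1 0 i), (p.2 0 i).
rewrite -xE -?yE in x0 xu y0 mx xm x1 *.
have M1 : 1 <= m%:R :> R by rewrite ler1n.
rewrite -natr1 in xm *.
rewrite addrK => hxy.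
set M : R := m%:R in mx xm M1 hxy.
(* s is the height of the point above the chord. *)
pose s := y - ((M + 1 - x) * (r / M) + (x - M) * (r / (M + 1))).
have s0 : 0 <= s.
  have -> : s = r / (M * (M + 1)) *
      ((x + (M + 1) * M * (y / r)) - (2 * (M + 1) - 1)).
    by rewrite /s; field; lra.
  by rewrite mulr_ge0 ?subr_ge0// divr_ge0 ?mulr_ge0; lra.
have step (a : nat) : (1 <= a <= u i)%N ->
    C (set_coord p i a%:R (r / a%:R + s)).
  move=> /andP[a1 au].
  have a0 : 0 < a%:R :> R by rewrite ltr0n.
  apply: (@one_product_hull R n r u C i) => //; rewrite /= ?mxE ?eqxx ?natr_nat//.
    move=> k; rewrite !mxE; case: eqP => [->|_]; last exact: pbox.
    by split; rewrite ?ler_nat// addr_ge0// divr_ge0// ltW.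
  by rewrite mulrDr mulrCA divff ?gt_eqF// mulr1 lerDl mulr_ge0// ltW.
apply: (@convex_coord R n C p i (M + 1 - x) (x - M) M (r / M + s)
  (M + 1) (r / (M + 1) + s) cC); rewrite -?xE -?yE; try lra; try ring.
- by rewrite /s; ring.
- by apply: step; rewrite m1.
- by rewrite natr1; apply: step.
Qed.

(** Splits off a part of weight [l] on which all forms are at least 1.  By
    homogeneity [(x / l, y / l)] does so, but it may leave the box when [x] is
    large; then [x] is capped at [m], where [lform_ge_product] gives all forms
    from the last one, and the excess goes to the other part. *)
Lemma split_coord (R : realType) (r : R) (m : nat) (x y l : R) :
  0 < r -> (0 < m)%N -> in_box m x y -> 0 <= l <= 1 ->
  (forall k, (1 <= k <= m.+1)%N -> l <= lform r m k x y) ->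
  exists v w : R * R,
    [/\ x = l * v.1 + (1 - l) * w.1, y = l * v.2 + (1 - l) * w.2,
        in_box m w.1 w.2 &
        0 < l -> in_box m v.1 v.2 /\
          (forall k, (1 <= k <= m.+1)%N -> 1 <= lform r m k v.1 v.2)].
Proof.
move=> r0 m0 [x0 xm y0] /andP[l0 l1] hl.
have [l00|ln0] := eqVneq l 0.
  exists (0, 0), (x, y); rewrite l00 /=; split; [ring|ring|by []|by rewrite ltxx].
have lp : 0 < l by rewrite lt_neqAle eq_sym ln0.
have m0R : 0 <= m%:R :> R by [].
have yl0 : 0 <= y / l by rewrite divr_ge0.
have [xl|xl] := leP x (l * m%:R).
  exists (x / l, y / l), (0, 0) => /=; split.
  - by field.
  - by field.
  - by split.
  move=> _; split; first by split; rewrite ?divr_ge0// ler_pdivrMr// mulrC.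
  move=> k /hl; rewrite -[X in X <= _](mulr1 l).
  have -> : lform r m k x y = l * lform r m k (x / l) (y / l).
    have := lform_combo r m k l 0 (x / l) (y / l) 0 0.
    rewrite !mul0r !addr0 => <-.
    by congr lform; field.
  by rewrite ler_pM2l.
have l1' : 0 < 1 - l by nra.
exists (m%:R, y / l), ((x - l * m%:R) / (1 - l), 0) => /=; split.
- by field; lra.
- by field.
- by split; rewrite ?divr_ge0 ?ler_pdivrMr//; nra.
move=> _; split=> // k km.
have := @lform_ge_product R r m k m (y / l) r0 km (leqnn m) yl0.
apply: le_trans; rewrite le_min lexx/=.
have := hl m.+1; rewrite leqnn => /(_ isT).
rewrite lform_lastE (_ : m%:R * (y / l / r) = m%:R * (y / r) / l).
  by rewrite ler_pdivlMr// mul1r.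
by field; lra.
Qed.

(** The weights [g i / \sum g] sum to 1 and are bounded by the forms of their
    coordinates.  The [i]-th point of the combination takes the strong part of
    [split_coord] at coordinate [i] and the weak parts elsewhere, so it is in the
    hull by [one_strong_coord_hull], and in each coordinate the combination
    recovers the given point. *)
Lemma hull_of_lower_bounds (R : realType) (n : nat) (r : R) (u : 'I_n -> nat)
    (p : xyspace R n) (g : 'I_n -> R) :
  0 < r -> (forall i, (0 < u i)%N) ->
  (forall i, in_box (u i) (p.1 0 i) (p.2 0 i)) ->
  (forall i, 0 <= g i) ->
  (forall i k, (1 <= k <= (u i).+1)%N -> g i <= lform r (u i) k (p.1 0 i) (p.2 0 i)) ->
  1 <= \sum_i g i -> conv_hull (SU r u) p.
Proof.
move=> r0 u0 pbox g0 gl G1 C [cC SC].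
set G := \sum_i g i in G1.
have Gp : 0 < G by lra.
pose l i := g i / G.
have l0 i : 0 <= l i by rewrite divr_ge0// ltW.
have ls : \sum_i l i = 1 by rewrite -mulr_suml divff// gt_eqF.
have l1 i : l i <= 1.
  by rewrite -ls (bigD1 i)//= lerDl sumr_ge0.
have lg i : l i <= g i by rewrite ler_pdivrMr// ler_peMr.
have /choice[vw H] : forall i, exists vw : (R * R) * (R * R),
    [/\ p.1 0 i = l i * vw.1.1 + (1 - l i) * vw.2.1,
        p.2 0 i = l i * vw.1.2 + (1 - l i) * vw.2.2,
        in_box (u i) vw.2.1 vw.2.2 &
        0 < l i -> in_box (u i) vw.1.1 vw.1.2 /\
          (forall k, (1 <= k <= (u i).+1)%N -> 1 <= lform r (u i) k vw.1.1 vw.1.2)].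
  move=> i; have [||v [w h]] := @split_coord R r (u i) (p.1 0 i) (p.2 0 i) (l i)
    r0 (u0 i) (pbox i); last by exists (v, w).
    by rewrite l0 l1.
  by move=> k /(gl i); apply: le_trans.
pose P i : xyspace R n :=
  (\row_j (if j == i then (vw j).1.1 else (vw j).2.1),
   \row_j (if j == i then (vw j).1.2 else (vw j).2.2)).
have others j (a b : R) : \sum_i l i * (if j == i then a else b)
    = l j * a + (1 - l j) * b.
  rewrite (bigD1 j)//= eqxx; congr (_ + _).
  rewrite -ls [in RHS](bigD1 j)//= addrAC subrr add0r mulr_suml.
  by apply: eq_bigr => i; rewrite eq_sym => /negPf->.
have -> : p = \sum_i l i *: P i.
  rewrite [RHS]surjective_pairing (surjective_pairing p).
  congr pair; apply/rowP => j; rewrite ?(raddf_sum (@fst _ _)) ?(raddf_sum (@snd _ _)) summxE.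
    by under eq_bigr do rewrite !mxE; rewrite others; case: (H j).
  by under eq_bigr do rewrite !mxE; rewrite others; case: (H j).
apply: convex_sum => // i li; have [_ _ _ /(_ li)[vb vl]] := H i.
apply: (@one_strong_coord_hull R n r u C i) => //.
  move=> j; rewrite !mxE; case: eqP => [->//|_]; by case: (H j).
by move=> k; rewrite !mxE eqxx; apply: vl.
Qed.

(** * The smallest form in constant time *)

(** In the order of increasing [k], the form of index [k + 1] is at most the one
    of index [k] exactly when [k^2 * y <= x * r]; hence the minimiser is the
    first [k] with [k^2 * y > x * r], that is [floor (sqrt (x r / y)) + 1], capped
    at [m + 1].  The comparison made first also covers [y = 0]. *)
Definition best_index (R : realType) (r : R) (m : nat) (x y : R) : nat :=
  if m%:R * m%:R * y <= x * r then m.+1 else (Num.truncn (Num.sqrt (x * r / y))).+1.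

(** The difference of the forms of indices [j] and [k] has the sign of
    [(k - j) * (2 x - (2 j k - j - k + 1) y / r)], where
    [2 j k - j - k + 1] is at most [2 (k - 1)^2] for [j < k] and at least
    [2 k^2] for [j > k]. *)
Lemma lform_min (R : realType) (r : R) (m k : nat) (x y : R) :
  0 < r -> (1 <= k <= m)%N ->
  (k%:R - 1) ^+ 2 * (y / r) <= x <= k%:R ^+ 2 * (y / r) ->
  0 <= y ->
  forall j, (1 <= j <= m.+1)%N -> lform r m k x y <= lform r m j x y.
Proof.
move=> r0 k1m + y0 j /andP[j1].
set Y := y / r; have Y0 : 0 <= Y by rewrite divr_ge0// ltW.
move=> /andP[xk kx].
have /andP[k1 km] := k1m.
have k1R : 1 <= k%:R :> R by rewrite ler1n.
have kmR : k%:R <= m%:R :> R by rewrite ler_nat.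
have j1R : 1 <= j%:R :> R by rewrite ler1n.
rewrite leq_eqVlt ltnS => /orP[/eqP->|jm].
  rewrite lform_lastE lformE// ler_pdivrMr ?twice_sub1_gt0// -/Y.
  have : k%:R * Y <= m%:R * Y by rewrite ler_wpM2r.
  nra.
rewrite !lformE ?j1// ler_pdivrMr ?twice_sub1_gt0// [leRHS]mulrAC ler_pdivlMr ?twice_sub1_gt0// -/Y.
have [jk|kj|->//] := ltngtP j k.
- have jkR : j%:R + 1 <= k%:R :> R by rewrite natr1 ler_nat.
  rewrite -subr_ge0.
  have -> : (x + j%:R * (j%:R - 1) * Y) * (2 * k%:R - 1) -
    (x + k%:R * (k%:R - 1) * Y) * (2 * j%:R - 1) =
    (k%:R - j%:R) * (2 * x - (2 * (j%:R * k%:R) - j%:R - k%:R + 1) * Y) by ring.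
  rewrite mulr_ge0//; first by lra.
  have : (2 * (j%:R * k%:R) - j%:R - k%:R + 1) * Y <= 2 * (k%:R - 1) ^+ 2 * Y.
    by rewrite ler_wpM2r//; nra.
  by lra.
have jkR : k%:R + 1 <= j%:R :> R by rewrite natr1 ler_nat.
rewrite -subr_ge0.
have -> : (x + j%:R * (j%:R - 1) * Y) * (2 * k%:R - 1) -
  (x + k%:R * (k%:R - 1) * Y) * (2 * j%:R - 1) =
  (j%:R - k%:R) * ((2 * (j%:R * k%:R) - j%:R - k%:R + 1) * Y - 2 * x) by ring.
rewrite mulr_ge0//; first by lra.
have : 2 * k%:R ^+ 2 * Y <= (2 * (j%:R * k%:R) - j%:R - k%:R + 1) * Y.
  by rewrite ler_wpM2r//; nra.
by lra.
Qed.

Lemma best_index_middle (R : realType) (r : R) (m : nat) (x y : R) :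
  0 < r -> 0 <= x -> 0 <= y -> x * r < m%:R * m%:R * y ->
  let k := best_index r m x y in
  (1 <= k <= m)%N /\ (k%:R - 1) ^+ 2 * (y / r) <= x <= k%:R ^+ 2 * (y / r).
Proof.
move=> r0 x0 y0 xy; rewrite /best_index leNgt xy /=.
have y1 : 0 < y.
  rewrite lt_neqAle y0 andbT; apply: contraTneq xy => <-.
  by rewrite mulr0 -leNgt mulr_ge0// ltW.
set q := x * r / y; have q0 : 0 <= q by rewrite divr_ge0// mulr_ge0// ltW.
have qE : q * (y / r) = x by rewrite /q; field; lra.
have sq := sqr_sqrtr q0; have s0 := sqrtr_ge0 q.
have /andP := truncn_itv s0; set k := Num.truncn _ => -[ks sk].
have mq : q < m%:R * m%:R by rewrite ltr_pdivrMr.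
have k0 : 0 <= k%:R :> R by [].
split.
  rewrite -(ltr_nat R) (le_lt_trans ks)//; have m0 : 0 <= m%:R :> R by [].
  by rewrite ltNge; apply/negP => ?; nra.
have yr0 : 0 <= y / r by rewrite divr_ge0// ltW.
rewrite -natr1 in sk *; rewrite addrK -qE.
by rewrite !ler_wpM2r//; nra.
Qed.

Lemma best_indexP (R : realType) (r : R) (m : nat) (x y : R) :
  0 < r -> 0 <= x -> 0 <= y ->
  (1 <= best_index r m x y <= m.+1)%N /\
  forall j, (1 <= j <= m.+1)%N ->
    lform r m (best_index r m x y) x y <= lform r m j x y.
Proof.
move=> r0 x0 y0; have [h|xy] := leP (m%:R * m%:R * y) (x * r).
  rewrite /best_index h leqnn; split=> // j /andP[j1]; rewrite leq_eqVlt ltnS => /orP[/eqP->//|jm].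
  rewrite lform_lastE lformE ?j1// ler_pdivlMr ?twice_sub1_gt0//.
  set Y := y / r; have Y0 : 0 <= Y by rewrite divr_ge0// ltW.
  have : m%:R * m%:R * Y <= x by rewrite mulrA ler_pdivrMr.
  have j1R : 1 <= j%:R :> R by rewrite ler1n.
  have jmR : j%:R <= m%:R :> R by rewrite ler_nat.
  move: j%:R m%:R j1R jmR => a b a1 ab h'.
  have : 0 <= ((b - a) ^+ 2 + (b - a)) * Y by rewrite mulr_ge0// addr_ge0 ?sqr_ge0//; lra.
  nra.
have [/andP[k1 km] kx] := best_index_middle r0 x0 y0 xy.
split; first by rewrite k1 ltnW.
by apply: lform_min; rewrite // k1.
Qed.

(** * Executing programs *)

Fixpoint loop_free (c : cmd) : bool :=
  match c with
  | Skip | Write _ _ _ => true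
  | Seq c1 c2 | If _ c1 c2 => loop_free c1 && loop_free c2
  | While _ _ => false
  end.

(** On loop-free commands [exec] is this total function, which can be computed by
    simplification; [exec_run] makes the link. *)
Fixpoint run (R : realType) (s : store R) (c : cmd) : store R :=
  match c with
  | Skip | While _ _ => s
  | Write a e1 e2 => update s a (Num.truncn (eval s e1)) (eval s e2)
  | Seq c1 c2 => run (run s c1) c2
  | If t c1 c2 => if evalt s t then run s c1 else run s c2
  end.

Fixpoint max_cost (c : cmd) : nat :=
  match c with
  | Skip | While _ _ => 1
  | Write _ e1 e2 => (ecost e1 + ecost e2).+1
  | Seq c1 c2 => max_cost c1 + max_cost c2
  | If t c1 c2 => (tcost t + maxn (max_cost c1) (max_cost c2)).+1
  end.

Lemma exec_run (R : realType) (c : cmd) (s : store R) : loop_free c ->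
  exists2 T, exec c s (run s c) T & (T <= max_cost c)%N.
Proof.
elim: c s => [|a e1 e2|c1 IH1 c2 IH2|t c1 IH1 c2 IH2|//] s /=.
- by move=> _; exists 1%N => //; constructor.
- by move=> _; eexists; first exact: exec_write.
- case/andP => /(IH1 s)[T1 e1 h1] /(IH2 (run s c1))[T2 e2 h2].
  by exists (T1 + T2)%N; [apply: exec_seq e1 e2|apply: leq_add].
case/andP => /(IH1 s)[T1 e1 h1] /(IH2 s)[T2 e2 h2].
case: ifPn => st.
  exists (tcost t + T1).+1; first exact: exec_if_true.
  by rewrite ltnS leq_add2l leq_max h1.
exists (tcost t + T2).+1; first exact: exec_if_false.
by rewrite ltnS leq_add2l leq_max h2 orbT.
Qed.

(** A loop whose guard is equivalent to [i < n] along an invariant [I i] runs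
    exactly [n] times, at linear cost since each passage through a loop-free
    body costs at most a constant. *)
Lemma exec_for (R : realType) (t : test) (c : cmd) (n : nat)
    (I : nat -> store R -> Prop) :
  loop_free c ->
  (forall i s, (i <= n)%N -> I i s -> evalt s t = (i < n)%N) ->
  (forall i s, (i < n)%N -> I i s -> I i.+1 (run s c)) ->
  forall s, I 0%N s -> exists s' T,
    [/\ exec (While t c) s s' T, I n s' &
        (T <= n * (tcost t + max_cost c).+1 + (tcost t).+1)%N].
Proof.
move=> lf test step s I0.
suff H d i s1 : (i + d = n)%N -> I i s1 -> exists s' T,
    [/\ exec (While t c) s1 s' T, I n s' &
        (T <= d * (tcost t + max_cost c).+1 + (tcost t).+1)%N].
  exact: (H n 0%N).
elim: d i s1 => [|d IH] i s1 id_n Ii.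
  rewrite addn0 in id_n; rewrite id_n in Ii.
  exists s1, (tcost t).+1; split=> //.
  by apply: exec_while_false; rewrite (test n)// ltnn.
have i_n : (i < n)%N by lia.
have [T1 e1 h1] := exec_run s1 lf.
have [|s' [T2 [e2 In h2]]] := IH i.+1 (run s1 c) _ (step _ _ i_n Ii); first by lia.
exists s', (tcost t + T1 + T2).+1; split=> //; last by lia.
by apply: exec_while_true e1 e2; rewrite (test i)// ltnW.
Qed.

(** * The separation program *)

(** The first array names that are neither input nor output. *)
Definition counter := 8%N.
Definition total := 9%N.

Definition scalar (a : nat) : expr := ERead a (EConst 0).
Definition current (a : nat) : expr := ERead a (scalar counter).
Definition set_scalar (a : nat) (e : expr) : cmd := Write a (EConst 0) e.
Definition set_current (a : nat) (e : expr) : cmd := Write a (scalar counter) e.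

Definition report (tag : int) : cmd :=
  Seq (set_scalar out_tag (EConst tag)) (set_scalar out_idx (scalar counter)).

Definition add_form (k e : expr) : cmd :=
  Seq (set_current out_k k) (set_scalar total (EAdd (scalar total) e)).

(** These two expressions copy the two branches of [lform] literally, so that the
    computed total is the left-hand side of the returned inequality. *)
Definition last_form : expr :=
  EDiv (current in_y) (EDiv (scalar in_r) (current in_u)).

Definition twice_pred : expr :=
  ESub (EMul (EConst 2) (current out_k)) (EConst 1).

Definition middle_form : expr :=
  EAdd (EMul (EDiv (EConst 1) twice_pred) (current in_x))
       (EMul (EDiv (EMul (current out_k) (ESub (current out_k) (EConst 1)))
                   (EMul (scalar in_r) twice_pred))
             (current in_y)).

Definition add_best_form : cmd :=
  If (TLe (EMul (EMul (current in_u) (current in_u)) (current in_y))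
          (EMul (current in_x) (scalar in_r)))
     (add_form (EAdd (current in_u) (EConst 1)) last_form)
     (add_form
        (EAdd (EFloor (ESqrt (EDiv (EMul (current in_x) (scalar in_r))
                                   (current in_y))))
              (EConst 1))
        middle_form).

Definition process_coordinate : cmd :=
  If (TLt (current in_u) (current in_x)) (report 1)
  (If (TLt (current in_x) (EConst 0)) (report 2)
  (If (TLt (current in_y) (EConst 0)) (report 3)
  add_best_form)).

Definition loop_body : cmd :=
  Seq process_coordinate
      (set_scalar counter (EAdd (scalar counter) (EConst 1))).

Definition loop_test : test := TLt (scalar counter) (scalar in_n).

Definition conclude : cmd :=
  If (TAnd (TLe (scalar out_tag) (EConst 0)) (TLt (scalar total) (EConst 1)))
     (set_scalar out_tag (EConst 4)) Skip.

(** A violated bound does not interrupt the scan: the tag stays nonzero, and later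
    violations only replace the reported one. *)
Definition separation : cmd := Seq (While loop_test loop_body) conclude.

(** * Correctness of the program *)

Definition best_k (R : realType) (n : nat) (r : R) (u : 'I_n -> nat)
    (p : xyspace R n) (j : 'I_n) : nat :=
  best_index r (u j) (p.1 0 j) (p.2 0 j).

Definition best_value (R : realType) (n : nat) (r : R) (u : 'I_n -> nat)
    (p : xyspace R n) (j : 'I_n) : R :=
  lform r (u j) (best_k r u p j) (p.1 0 j) (p.2 0 j).

Definition is_bound (n : nat) (c : ineq n) : bool :=
  if c is LSum _ then false else true.

(** After a violated bound has been reported, nothing more is claimed about the
    running total and the indices, which may then be meaningless. *)
Definition scanned (R : realType) (n : nat) (r : R) (u : 'I_n -> nat)
    (p : xyspace R n) (i : nat) (s : store R) : Prop :=
  (exists c : ineq n,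
     [/\ is_bound c, returns s (Some c) & ~ satisfies r u c p]) \/
  [/\ s out_tag 0%N = 0,
      s total 0%N = \sum_(j < n | (j < i)%N) best_value r u p j &
      forall j : 'I_n, (j < i)%N ->
        in_box (u j) (p.1 0 j) (p.2 0 j) /\ s out_k j = (best_k r u p j)%:R].

(** The bound 5 is the number of input arrays, which the program never writes. *)
Definition loop_inv (R : realType) (n : nat) (r : R) (u : 'I_n -> nat)
    (p : xyspace R n) (i : nat) (s : store R) : Prop :=
  [/\ forall a j, (a < 5)%N -> s a j = input r u p a j,
      s counter 0%N = i%:R & scanned r u p i s].

Lemma vec_arrayE (R : realType) (n : nat) (v : 'I_n -> R) (i : 'I_n) :
  vec_array v i = v i.
Proof. by rewrite /vec_array valK. Qed.

Lemma process_coordinate_inv (R : realType) (n : nat) (r : R) (u : 'I_n -> nat)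
    (p : xyspace R n) (i : 'I_n) (s : store R) : 0 < r ->
  loop_inv r u p i s ->
  let s' := run s process_coordinate in
  [/\ forall a j, (a < 5)%N -> s' a j = input r u p a j,
      s' counter 0%N = (i : nat)%:R & scanned r u p i.+1 s'].
Proof.
move=> r0 [inp ctr sc].
have tr0 : Num.truncn (0%:~R : R) = 0%N by exact: truncn0.
have hr : s in_r 0%N = r by rewrite inp.
have hu : s in_u i = (u i)%:R by rewrite inp//= /input/= vec_arrayE.
have hx : s in_x i = p.1 0 i by rewrite inp//= /input/= vec_arrayE.
have hy : s in_y i = p.2 0 i by rewrite inp//= /input/= vec_arrayE.
rewrite /process_coordinate /= !tr0 !ctr !natrK hu hx hy hr.
have upd a b k v j : (a < 5)%N -> (5 <= b)%N ->
    update s b k v a j = input r u p a j.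
  by move=> a5 b5; rewrite /update ltn_eqF ?inp//; lia.
have upd2 a b k v b' k' v' j : (a < 5)%N -> (5 <= b)%N -> (5 <= b')%N ->
    update (update s b k v) b' k' v' a j = input r u p a j.
  by move=> a5 b5 b5'; rewrite {1}/update ltn_eqF ?upd//; lia.
case: ifPn => [xu|]; last rewrite -leNgt => xu.
  split=> [a j a5||]; [by rewrite upd2|by []|].
  left; exists (XUpper i); split=> //=.
  by apply/negP; rewrite -ltNge.
case: ifPn => [x0|]; last rewrite -leNgt => x0.
  split=> [a j a5||]; [by rewrite upd2|by []|].
  left; exists (XLower i); split=> //=.
  by apply/negP; rewrite -ltNge.
case: ifPn => [y0|]; last rewrite -leNgt => y0.
  split=> [a j a5||]; [by rewrite upd2|by []|].
  left; exists (YLower i); split=> //=.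
  by apply/negP; rewrite -ltNge.
suff H (v : R) (w : R) : v = (best_k r u p i)%:R -> w = best_value r u p i ->
    let s' := update (update s out_k i v) total 0 (s total 0%N + w) in
    [/\ forall a j, (a < 5)%N -> s' a j = input r u p a j,
      s' counter 0%N = (i : nat)%:R & scanned r u p i.+1 s'].
  case: ifPn => hb.
    apply: H; rewrite /best_value /best_k /best_index hb ?natr1//.
    by rewrite /update /= ?(tr0, ctr, natrK) hu hy hr /lform eqxx.
  (* The program computes an integer floor, best_index a natural truncation. *)
  have kE : (Num.floor (Num.sqrt (p.1 0 i * r / p.2 0 i)))%:~R + 1%:~R =
     (best_k r u p i)%:R :> R.
    rewrite /best_k /best_index (negPf hb) -natr1; congr (_ + _).
    by rewrite truncn_floor sqrtr_ge0 natr_absz ger0_norm// floor_ge0 sqrtr_ge0.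
  apply: H => //.
  rewrite /update /= ?(tr0, ctr, natrK) eqxx /= hx hy hr kE.
  have [|/andP[_ km] _] := @best_index_middle R r (u i) (p.1 0 i) (p.2 0 i) r0 x0 y0.
    by rewrite ltNge.
  by rewrite /best_value /lform ltn_eqF// ltnS.
move=> vE wE s'; split=> [a j a5||]; [by rewrite /s' upd2|by []|].
case: sc => [[c [cb cr cs]]|[tag0 tot box]]; [left|right].
  exists c; split=> //; case: c cb cr {cs} => //.
split=> //.
  rewrite /s' /update /= tot wE (bigD1 i (P := fun j : 'I_n => (j < i.+1)%N))//=.
  rewrite addrC; congr (_ + _); apply: eq_bigl => j.
  by rewrite ltnS [LHS]ltn_neqAle (inj_eq val_inj) andbC.
move=> j; rewrite ltnS leq_eqVlt => /orP[/eqP/val_inj->|ji].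
  by split; [|rewrite /s' /update /= eqxx].
have [bj kj] := box j ji; split=> //.
by rewrite /s' /update /= ltn_eqF.
Qed.

Lemma loop_body_inv (R : realType) (n : nat) (r : R) (u : 'I_n -> nat)
    (p : xyspace R n) (i : nat) (s : store R) : 0 < r -> (i < n)%N ->
  loop_inv r u p i s -> loop_inv r u p i.+1 (run s loop_body).
Proof.
move=> r0 i_n inv.
have [inp ctr sc] := @process_coordinate_inv R n r u p (Ordinal i_n) s r0 inv.
rewrite -[run s loop_body]/(run (run s process_coordinate)
  (set_scalar counter (EAdd (scalar counter) (EConst 1)))).
move: (run s process_coordinate) inp ctr sc.
move=> {inv}s inp ctr sc.
have tr0 : Num.truncn (0%:~R : R) = 0%N by exact: truncn0.
(* The counter is stored in an array that scanned does not read. *)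
rewrite /= !tr0 ctr natr1; split=> // a j a5.
by rewrite /update ltn_eqF ?inp// (leq_trans a5).
Qed.

Lemma separation_correct (R : realType) (n : nat) (r : R) (u : 'I_n -> nat)
    (p : xyspace R n) : (1 <= n)%N -> 0 < r -> (forall i, (0 < u i)%N) ->
  exists (s : store R) (T : nat) (ans : option (ineq n)),
    [/\ exec separation (input r u p) s T,
        (T <= ((tcost loop_test + max_cost loop_body).+1 +
               ((tcost loop_test).+1 + max_cost conclude)) * n)%N,
        returns s ans,
        (ans = None <-> conv_hull (SU r u) p)
      & forall c : ineq n, ans = Some c ->
          admissible u c /\ ~ satisfies r u c p].
Proof.
move=> n1 r0 u0.
have tr0 : Num.truncn (0%:~R : R) = 0%N by exact: truncn0.
have [//|i s i_n [inp ctr _]|i s i_n||s [T [ex1 [_ _ sc] T1]]] :=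
    @exec_for R loop_test loop_body n (loop_inv r u p) _ _ _ (input r u p).
- by rewrite /= !tr0 ctr inp//= ltr_nat.
- exact: loop_body_inv.
- split=> //; right; split=> //.
  by rewrite big_pred0.
have [//|T' ex2 T2] := @exec_run R conclude s.
have ex : exec separation (input r u p) (run s conclude) (T + T').
  exact: exec_seq ex1 ex2.
have TT : (T + T' <= ((tcost loop_test + max_cost loop_body).+1 +
               ((tcost loop_test).+1 + max_cost conclude)) * n)%N.
  move: (tcost loop_test + _).+1 (tcost loop_test).+1 (max_cost conclude) T1 T2.
  by move=> a b c; nia.
have viol c : admissible u c -> ~ satisfies r u c p ->
    (Some c = None <-> conv_hull (SU r u) p) /\
    (forall c', Some c = Some c' -> admissible u c' /\ ~ satisfies r u c' p).
  move=> adm nsat; split; last by move=> c' [<-].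
  by split=> // /(hull_satisfies r0 adm).
exists (run s conclude), (T + T')%N.
case: sc => [[c [cb cr cs]]|[tag0 tot box]].
  have tag_gt0 : 0 < s out_tag 0%N by case: c cb cr {cs} => //= j _ [-> _].
  have [|//|h1 h2] := viol c; first by case: c cb {cr cs}.
  by exists (Some c); split=> //; rewrite /= !tr0 lt_geF.
have boxes i : in_box (u i) (p.1 0 i) (p.2 0 i) by case: (box i (ltn_ord i)).
have best i : (1 <= best_k r u p i <= (u i).+1)%N /\
    forall k, (1 <= k <= (u i).+1)%N ->
      best_value r u p i <= lform r (u i) k (p.1 0 i) (p.2 0 i).
  by have [? _ ?] := boxes i; apply: best_indexP.
have totE : s total 0%N = \sum_j best_value r u p j.
  by rewrite tot; apply: eq_bigl => j; rewrite ltn_ord.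
have runE : run s conclude =
    if \sum_j best_value r u p j < 1 then update s out_tag 0 4 else s.
  by rewrite /= !tr0 tag0 totE lexx.
rewrite runE in ex *.
case: ifPn ex => [lt1|]; last rewrite -leNgt => ge1 ex.
  move=> ex; have [|h1 h2] := viol (LSum (best_k r u p)) (fun i => proj1 (best i)).
    by rewrite /=; apply/negP; rewrite -ltNge.
  exists (Some (LSum (best_k r u p))); split=> //=; split=> // i.
  by rewrite /update /=; case: (box i (ltn_ord i)).
exists None; split=> //; split=> // _.
apply: (@hull_of_lower_bounds R n r u p (best_value r u p)) => // i.
  have [x0 _ y0] := boxes i.
  by apply: lform_ge0 => //; case: (best i).
by case: (best i).
Qed.

Theorem proposition5 (R : realType) :
  (forall (n : nat) (r : R) (u : 'I_n -> nat),
      (1 <= n)%N -> 0 < r -> (forall i, (0 < u i)%N) ->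
      forall c : ineq n, admissible u c ->
      forall p : xyspace R n, conv_hull (SU r u) p -> satisfies r u c p)
  /\
  (exists (P : cmd) (C : nat),
    forall (n : nat) (r : R) (u : 'I_n -> nat) (p : xyspace R n),
      (1 <= n)%N -> 0 < r -> (forall i, (0 < u i)%N) ->
      exists (s : store R) (T : nat) (ans : option (ineq n)),
        [/\ exec P (input r u p) s T,
            (T <= C * n)%N,
            returns s ans,
            (ans = None <-> conv_hull (SU r u) p)
          & forall c : ineq n, ans = Some c ->
              admissible u c /\ ~ satisfies r u c p]).
Proof.
split=> [n r u _ r0 _ c adm p|]; first exact: hull_satisfies.
by exists separation; eexists => n r u p; apply: separation_correct.
Qed.
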